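(* Let $\pi_1,\ldots,\pi_k$ be chosen independently and uniformly at random (with replacement) from the symmetric group $S_n$, where $k=k(n)\le\frac{3\lg n-\omega(n)}{\lg 1.2}$ for some function $\omega(n)\to\infty$. Then the probability that $\{\pi_1,\ldots,\pi_k\}$ shatters every triple of positions $i_1<i_2<i_3$ in $[n]$ tends to $0$ as $n\to\infty$.
   Context: $\lg=\log_2$. The permutations $\pi_1,\dots,\pi_k$ (written in one-line notation) shatter the positions $i_1<i_2<i_3$ if for every $\rho\in S_3$ there is some $j$ such that $(\pi_j(i_1),\pi_j(i_2),\pi_j(i_3))$ is order-isomorphic to $(\rho_1,\rho_2,\rho_3)$, i.e. $\pi_j(i_a)<\pi_j(i_b)$ iff $\rho_a<\rho_b$. *)

(* Defs.v *)
From HB Require Import structures.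
From mathcomp Require Export all_boot all_order all_algebra all_fingroup.
From mathcomp Require Export all_classical all_reals all_analysis.
Export Order.TTheory GRing.Theory Num.Theory.
Export numFieldNormedType.Exports.

Set Implicit Arguments.
Unset Strict Implicit.
Unset Printing Implicit Defensive.

Local Open Scope ring_scope.

Definition lg {R : realType} (x : R) : R := ln x / ln 2.

(* [n] is modelled by 'I_n and S_n by 'S_n; both are indexed from 0, which does
   not affect order-isomorphism. The one-line notation of pi lists its values
   pi i, the positions being the arguments. *)
Definition order_isomorphic_at (n : nat) (pi : 'S_n) (i : 3.-tuple 'I_n)
    (rho : 'S_3) : bool :=
  [forall a : 'I_3, forall b : 'I_3,
    (pi (tnth i a) < pi (tnth i b))%N == (rho a < rho b)%N].

Definition shatters (n k : nat) (p : {ffun 'I_k -> 'S_n}) (i : 3.-tuple 'I_n)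
    : bool :=
  [forall rho : 'S_3, exists j : 'I_k, order_isomorphic_at (p j) i rho].

Definition shatters_all_triples (n k : nat) (p : {ffun 'I_k -> 'S_n}) : bool :=
  [forall i1 : 'I_n, forall i2 : 'I_n, forall i3 : 'I_n,
    (i1 < i2 < i3)%N ==> shatters p [tuple i1; i2; i3]].

Definition uniform_pmf (R : realType) (T : finType) (x : T) : R :=
  #|T|%:R^-1.

(* Independence: the law of (p 0, ..., p (k-1)) on T^k is the product of its
   uniform marginals, so repetitions are allowed. *)
Definition iid_uniform_prob (R : realType) (T : finType) (k : nat)
    (E : pred {ffun 'I_k -> T}) : R :=
  \sum_(p : {ffun 'I_k -> T} | E p) \prod_(j < k) uniform_pmf R (p j).

(* Main.v *)
Require Import Defs.
From mathcomp Require Import zify ring lra.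

(* Second moment method. Split [n] into three consecutive blocks of length
   [m = n %/ 3] and let [X] count the triples with one position in each block on
   which none of the [k] permutations is increasing; shattering forces [X = 0].
   The mean of [X] is [m^3 (5/6)^k]. Two such triples agreeing on [d] positions
   are both increasing with probability [1/36], at most [1/20], [1/12], [1/6] for
   [d = 0, 1, 2, 3], whence
     [E X^2 / (E X)^2 - 1 <= 3 (129/125)^k / m + 3 (27/25)^k / m^2 + (6/5)^k / m^3].
   The hypothesis on [k] makes the last term tend to [0]; since
   [(129/125)^3 < 6/5] and [(27/25)^3 < (6/5)^2], so do the other two. *)

Set Implicit Arguments.
Unset Strict Implicit.
Unset Printing Implicit Defensive.

(** * Order patterns of a uniform random permutation *)

Definition respects (C : seq (nat * nat)) (s : seq nat) : bool :=
  all (fun c => nth 0 s c.1 < nth 0 s c.2) C.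

Lemma permutations_map (T U : eqType) (f : T -> U) (s : seq T) :
  uniq s -> {in s &, injective f} ->
  perm_eq (permutations (map f s)) (map (map f) (permutations s)).
Proof.
move=> us injf; rewrite perm_sym.
have um : uniq (map (map f) (permutations s)).
  rewrite map_inj_in_uniq ?permutations_uniq // => x y.
  rewrite !mem_permutations => /perm_mem px /perm_mem py.
  by apply: (inj_in_map injf); apply/allP => z; rewrite ?px ?py.
apply: uniq_perm => //; first exact: permutations_uniq.
(* A duplicate-free list contained in another that is no longer has the same elements. *)
refine (uniq_min_size um _ _).2.
  move=> x /mapP[t]; rewrite mem_permutations => pt ->.
  by rewrite mem_permutations perm_map.
by rewrite size_map !size_permutations ?size_map // map_inj_in_uniq.
Qed.

(** Only relative order matters: sorting [s] gives an increasing bijection from indices to entries,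
    which carries arrangements to arrangements and preserves every comparison in [C]. *)
Lemma count_respects_permutations (C : seq (nat * nat)) (s : seq nat) :
  uniq s -> all (fun c => (c.1 < size s) && (c.2 < size s)) C ->
  count (respects C) (permutations s)
  = count (respects C) (permutations (iota 0 (size s))).
Proof.
move=> us hC; set s' := sort leq s.
have ss : size s' = size s by rewrite size_sort.
have lts' : sorted ltn s'.
  by rewrite ltn_sorted_uniq_leq sort_uniq us sort_sorted //; exact: leq_total.
have hom := sorted_ltn_nth ltn_trans 0 lts'.
have mono : {in iota 0 (size s) &, {mono nth 0 s' : i j / i < j}}.
  move=> i j; rewrite !mem_iota !add0n -ss /= => hi hj.
  case: (ltngtP i j) => [|/hom h|->]; first exact: hom.
  - by apply: negbTE; rewrite -leqNgt ltnW // h.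
  - by rewrite ltnn.
have -> : count (respects C) (permutations s)
        = count (respects C) (permutations s').
  move: (respects C); apply/seq.permP; apply: uniq_perm;
    rewrite ?permutations_uniq // => t.
  by rewrite !mem_permutations /s' -(permPr (permEl (perm_sort leq s))).
have {1}-> : s' = map (nth 0 s') (iota 0 (size s)).
  by rewrite map_nth_iota0 -?ss ?take_size.
rewrite (seq.permP (permutations_map _ _)) ?iota_uniq //.
  rewrite count_map; apply: eq_in_count => t.
  rewrite mem_permutations => pt /=; apply: eq_in_all => c /(allP hC)/andP[h1 h2].
  have st : size t = size s by rewrite (perm_size pt) size_iota.
  rewrite !(nth_map 0) ?st //; apply: mono;
  by rewrite -(perm_mem pt) mem_nth ?st.
move=> i j hi hj /eqP; rewrite nth_uniq ?ss ?sort_uniq //.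
- by move/eqP.
- by move: hi; rewrite mem_iota.
- by move: hj; rewrite mem_iota.
Qed.

Lemma perm_eq_map_perm (T : finType) (p l : seq T) :
  uniq p -> perm_eq l p -> exists g : {perm T}, map g p = l.
Proof.
move=> up pl; have ul : uniq l by rewrite (perm_uniq pl).
have spl := perm_size pl.
(* Sends the [i]-th entry of [p] to the [i]-th entry of [l] and fixes every point outside [p]. *)
pose g x := if x \in p then nth x l (index x p) else x.
have inl x : x \in p -> g x \in p.
  by move=> xp; rewrite /g xp -(perm_mem pl) mem_nth // spl index_mem.
have gI : injective g.
  move=> x y; case: (boolP (x \in p)) (boolP (y \in p)) => [xp|xp] [yp|yp].
  - rewrite /g xp yp (set_nth_default y) ?spl ?index_mem // => /eqP.
    rewrite nth_uniq ?spl ?index_mem // => /eqP e.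
    by rewrite -(nth_index x xp) e nth_index.
  - by move=> e; move: (inl _ xp); rewrite e /g (negbTE yp) (negbTE yp).
  - by move=> e; move: (inl _ yp); rewrite -e /g (negbTE xp) (negbTE xp).
  - by rewrite /g (negbTE xp) (negbTE yp).
exists (perm gI); case: p l {pl} up ul spl @g gI inl => [|x0 p] l up ul spl g gI inl.
  by rewrite (size0nil spl).
apply: (@eq_from_nth _ x0); rewrite size_map // => i hi.
rewrite (nth_map x0) // permE /g mem_nth // index_uniq //.
by apply: set_nth_default; rewrite spl.
Qed.

(* Averaging over the rearrangements of [p]: the values of [pi] on [p] occur
   in each of the possible orders equally often. *)
Lemma card_perm_respects (n : nat) (p : seq 'I_n) (C : seq (nat * nat)) :
  uniq p -> all (fun c => (c.1 < size p) && (c.2 < size p)) C ->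
  (size p)`! * #|[pred pi : 'S_n | respects C [seq val (pi x) | x <- p]]|
  = n`! * count (respects C) (permutations (iota 0 (size p))).
Proof.
move=> up hC.
pose E (l : seq 'I_n) (pi : 'S_n) := respects C [seq val (pi x) | x <- l].
(* If [l] is the image of [p] under [g], then [pi] on [l] is [g * pi] on [p], and left
   multiplication by [g] is a bijection of the group. *)
have EE l : l \in permutations p -> \sum_(pi | E l pi) 1 = \sum_(pi | E p pi) 1.
  rewrite mem_permutations => /(perm_eq_map_perm up)[g <-].
  rewrite [RHS](reindex_inj (mulgI g)); apply: eq_bigl => pi.
  rewrite /E -map_comp; congr (respects C _).
  by apply: eq_map => x /=; rewrite permM.
transitivity (\sum_(l <- permutations p) \sum_(pi | E l pi) 1).
  rewrite (eq_big_seq _ EE) big_const_seq count_predT size_permutations //.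
  by rewrite iter_addn_0 mulnC sum1_card.
(* For fixed [pi], the inner sum runs over all arrangements of its distinct values on [p], so it
   does not depend on [pi]. *)
rewrite (exchange_big_dep xpredT) //=.
rewrite (eq_bigr (fun _ => count (respects C) (permutations (iota 0 (size p))))).
  by rewrite sum_nat_const card_Sn.
move=> pi _; rewrite sum1_count.
have uq : uniq [seq val (pi x) | x <- p].
  by rewrite map_inj_uniq // => x y /val_inj /perm_inj.
have := count_respects_permutations (C := C) uq.
rewrite size_map => <- //.
rewrite (seq.permP (permutations_map _ _)) // ?count_map // => x y _ _.
by move=> /val_inj /perm_inj.
Qed.

(** * Block triples and the chance that two of them are both increasing *)

Lemma inord_eq (n i j : nat) : i <= n -> j <= n ->
  (inord i == inord j :> 'I_n.+1) = (i == j).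
Proof. by move=> hi hj; rewrite -val_eqE /= !inordK. Qed.

Lemma block_subproof (n m : nat) (h : 3 * m <= n) (c : 'I_3) (a : 'I_m) : c * m + a < n.
Proof. by case: c a => [c hc] [a ha] /=; nia. Qed.

Definition block (n m : nat) (h : 3 * m <= n) (c : 'I_3) (a : 'I_m)
    : 'I_n := Ordinal (block_subproof h c a).

Lemma block_eq (n m : nat) (h : 3 * m <= n) (c d : 'I_3) (a b : 'I_m) :
  (block h c a == block h d b) = (c == d) && (a == b).
Proof.
rewrite -!val_eqE /=; apply/eqP/andP => [e|[/eqP-> /eqP-> //]].
suff cd : val c = val d.
  by split; apply/eqP => //; move: e; rewrite cd => /addnI.
by case: c d a b e => [c hc] [d hd] [a ha] [b hb] /=; nia.
Qed.

Definition increasing_perms (n m : nat) (h : 3 * m <= n)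
    (t : 'I_m * 'I_m * 'I_m) : {set 'S_n} :=
  [set pi : 'S_n | pi (block h (inord 0) t.1.1) < pi (block h (inord 1) t.1.2)
                   < pi (block h (inord 2) t.2)]%SET.

Definition agreements (m : nat) (t u : 'I_m * 'I_m * 'I_m) : nat :=
  (t.1.1 == u.1.1) + (t.1.2 == u.1.2) + (t.2 == u.2).

Lemma card_increasing (n m : nat) (h : 3 * m <= n)
    (t : 'I_m * 'I_m * 'I_m) :
  6 * #|increasing_perms h t| = n`!.
Proof.
pose p := [:: block h (inord 0) t.1.1; block h (inord 1) t.1.2; block h (inord 2) t.2].
have up : uniq p.
  by rewrite /= !inE !block_eq !inord_eq.
have := card_perm_respects (C := [:: (0, 1); (1, 2)]) up isT.
have -> : count (respects [:: (0, 1); (1, 2)]) (permutations (iota 0 (size p))) = 1.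
  by vm_compute.
rewrite muln1 => <-; congr (_ * _); apply: eq_card => pi.
by rewrite !inE /= andbT.
Qed.

(* The weights over [180] are the proportions [1/36], [1/20], [1/12], [1/6];
   the true proportion for a single common middle position is [1/30]. *)
Definition joint_weight (d : nat) : nat := nth 0 [:: 5; 9; 15; 30] d.

Lemma card_joint_increasing (n m : nat) (h : 3 * m <= n)
    (t u : 'I_m * 'I_m * 'I_m) :
  180 * #|increasing_perms h t :&: increasing_perms h u|%SET
  <= joint_weight (agreements t u) * n`!.
Proof.
(* With [p] listing the distinct positions of both triples and [C] the two chains rewritten as
   indices into [p], it remains to compare [c / (size p)!] with [w / 180]. *)
have key (p : seq 'I_n) C c w :
    uniq p -> all (fun c => (c.1 < size p) && (c.2 < size p)) C ->
    count (respects C) (permutations (iota 0 (size p))) = c ->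
    180 * c <= w * (size p)`! ->
    (forall pi, (pi \in increasing_perms h t) && (pi \in increasing_perms h u)
                = respects C [seq val (pi x) | x <- p]) ->
    180 * #|increasing_perms h t :&: increasing_perms h u|%SET <= w * n`!.
  move=> up hC hc le hE; have := card_perm_respects up hC; rewrite hc.
  rewrite (eq_card (B := (increasing_perms h t :&: increasing_perms h u)%SET)).
    have := fact_gt0 (size p); move: (size p)`! le => f le f0.
    by set v := #|_| => e; rewrite -(leq_pmul2l f0); nia.
  by move=> pi; rewrite finset.in_setI hE.
case: t u key => [[a b] c] [[a' b'] c'] key; rewrite /agreements /=.
pose x := block h (inord 0); pose y := block h (inord 1); pose z := block h (inord 2).
move: key.
case: (eqVneq a a') => [<-|na]; case: (eqVneq b b') => [<-|nb];
  case: (eqVneq c c') => [<-|nc] key.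
(* The counts are linear extensions of two glued chains: 2 when two positions are shared, 6 =
   binomial(4,2) for a shared end, 2 * 2 = 4 for a shared middle, 20 = binomial(6,3) for disjoint
   chains. *)
- apply: (key [:: x a; y b; z c] [:: (0, 1); (1, 2); (0, 1); (1, 2)] 1) => //;
    last by move=> pi; rewrite !inE /= andbT !andbA.
  by rewrite /= !inE !block_eq !inord_eq.
- apply: (key [:: x a; y b; z c; z c'] [:: (0, 1); (1, 2); (0, 1); (1, 3)] 2) => //;
    last by move=> pi; rewrite !inE /= andbT !andbA.
  by rewrite /= !inE !block_eq !inord_eq //= (negbTE nc).
- apply: (key [:: x a; y b; y b'; z c] [:: (0, 1); (1, 3); (0, 2); (2, 3)] 2) => //;
    last by move=> pi; rewrite !inE /= andbT !andbA.
  by rewrite /= !inE !block_eq !inord_eq //= (negbTE nb).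
- apply: (key [:: x a; y b; z c; y b'; z c']
              [:: (0, 1); (1, 2); (0, 3); (3, 4)] 6) => //;
    last by move=> pi; rewrite !inE /= andbT !andbA.
  by rewrite /= !inE !block_eq !inord_eq //= (negbTE nb) (negbTE nc).
- apply: (key [:: x a; x a'; y b; z c] [:: (0, 2); (2, 3); (1, 2); (2, 3)] 2) => //;
    last by move=> pi; rewrite !inE /= andbT !andbA.
  by rewrite /= !inE !block_eq !inord_eq //= (negbTE na).
- apply: (key [:: x a; y b; z c; x a'; z c']
              [:: (0, 1); (1, 2); (3, 1); (1, 4)] 4) => //;
    last by move=> pi; rewrite !inE /= andbT !andbA.
  by rewrite /= !inE !block_eq !inord_eq //= (negbTE na) (negbTE nc).
- apply: (key [:: x a; y b; z c; x a'; y b']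
              [:: (0, 1); (1, 2); (3, 4); (4, 2)] 6) => //;
    last by move=> pi; rewrite !inE /= andbT !andbA.
  by rewrite /= !inE !block_eq !inord_eq //= (negbTE na) (negbTE nb).
- apply: (key [:: x a; y b; z c; x a'; y b'; z c']
              [:: (0, 1); (1, 2); (3, 4); (4, 5)] 20) => //;
    last by move=> pi; rewrite !inE /= andbT !andbA.
  by rewrite /= !inE !block_eq !inord_eq //= (negbTE na) (negbTE nb) (negbTE nc).
Qed.

Lemma card_setC_increasing (n m : nat) (h : 3 * m <= n)
    (t : 'I_m * 'I_m * 'I_m) :
  6 * #|~: increasing_perms h t|%SET = 5 * n`!.
Proof.
have := card_increasing h t; have := cardsC (increasing_perms h t).
by rewrite card_Sn; lia.
Qed.

(** Inclusion-exclusion, with 1 - 1/6 - 1/6 = 120/180. *)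
Lemma card_setC_joint_increasing (n m : nat) (h : 3 * m <= n)
    (t u : 'I_m * 'I_m * 'I_m) :
  180 * #|~: (increasing_perms h t :|: increasing_perms h u)|%SET
  <= (120 + joint_weight (agreements t u)) * n`!.
Proof.
have ht := card_increasing h t; have hu := card_increasing h u.
have := card_joint_increasing h t u.
have := cardsUI (increasing_perms h t) (increasing_perms h u).
have := cardsC (increasing_perms h t :|: increasing_perms h u)%SET.
by rewrite card_Sn mulnDl; set w := _ * n`!; lia.
Qed.

(** * The second moment method on a finite uniform space *)

Local Open Scope ring_scope.

Lemma iid_uniform_probE (R : realType) (T : finType) (k : nat)
    (E : pred {ffun 'I_k -> T}) :
  iid_uniform_prob R E = #|E|%:R / #|{ffun 'I_k -> T}|%:R.
Proof.
rewrite /iid_uniform_prob (eq_bigr (fun=> #|T|%:R ^- k)); last first.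
  by move=> p _; rewrite /uniform_pmf prodr_const card_ord exprVn.
by rewrite sumr_const card_ffun card_ord natrX mulr_natl.
Qed.

(** Chebyshev's inequality without denominators. Let [X x] be the number of [i] with [x] in [A i],
    and [W] the size of [Omega]. The squares of [W * X x - S] sum to the right-hand side, and each
    [x] with [X x = 0] contributes [S ^+ 2]. *)
Lemma second_moment_bound (R : realFieldType) (Omega I : finType)
    (A : I -> {set Omega}) (S Q : R) :
  S = \sum_i #|A i|%:R ->
  Q = \sum_i \sum_j #|A i :&: A j|%SET%:R ->
  S ^+ 2 * #|[pred x | [forall i, x \notin A i]]|%:R
  <= #|Omega|%:R * (#|Omega|%:R * Q - S ^+ 2).
Proof.
move=> -> ->; set S' := \sum_i _; set Q' := \sum_i _; set W := #|Omega|%:R.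
pose X (x : Omega) : R := \sum_i (x \in A i)%:R.
have cardE (B : {set Omega}) : #|B|%:R = \sum_x (x \in B)%:R :> R.
  by rewrite -sum1_card natr_sum big_mkcond /=; apply: eq_bigr => x _; case: ifP.
have SE : S' = \sum_x X x.
  by rewrite exchange_big /=; apply: eq_bigr => i _.
have QE : Q' = \sum_x X x ^+ 2.
  rewrite (eq_bigr (fun x => \sum_i \sum_j ((x \in A i)%:R * (x \in A j)%:R : R))).
    rewrite exchange_big /=; apply: eq_bigr => i _.
    rewrite exchange_big /=; apply: eq_bigr => j _.
    by rewrite cardE; apply: eq_bigr => x _; rewrite finset.in_setI -natrM mulnb.
  by move=> x _; rewrite expr2 /X big_distrlr.
have -> : W * (W * Q' - S' ^+ 2) = \sum_x (W * X x - S') ^+ 2.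
  transitivity (\sum_x (W ^+ 2 * X x ^+ 2 - 2 * W * S' * X x + S' ^+ 2)).
    rewrite big_split sumrB /= -!mulr_sumr -QE -SE sumr_const.
    rewrite -[_ *+ _]mulr_natl -/W.
    ring.
  by apply: eq_bigr => x _; ring.
rewrite mulr_natr -sumr_const.
rewrite [leRHS](bigID [pred x | [forall i, x \notin A i]]) /=.
rewrite -[leLHS]addr0 lerD //; last by apply: sumr_ge0 => x _; exact: sqr_ge0.
rewrite le_eqVlt; apply/orP; left; apply/eqP.
apply: eq_big => x; rewrite ?inE //= => /forallP hx.
suff -> : X x = 0 by ring.
by rewrite /X big1 // => i _; rewrite (negbTE (hx i)).
Qed.

Lemma sum_pair_mul (R : comRingType) (I J : finType) (F : I -> I -> R)
    (G : J -> J -> R) :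
  \sum_(t : I * J) \sum_(u : I * J) F t.1 u.1 * G t.2 u.2
  = (\sum_i \sum_i' F i i') * (\sum_j \sum_j' G j j').
Proof.
rewrite [RHS]big_distrlr [RHS]pair_bigA /=; apply: eq_bigr => t _.
by rewrite big_distrlr /= pair_bigA.
Qed.

(* Bounds the probability of being increasing on neither triple, divided by
   the value [(5/6)^2] it would have under independence. *)
Definition joint_ratio (R : realType) (d : nat) : R :=
  (120 + joint_weight d)%:R / 125.

Lemma joint_ratio_ge0 (R : realType) (d : nat) : 0 <= joint_ratio R d.
Proof. by rewrite divr_ge0. Qed.

(** Each set of coordinates contributes the pairs that agree at least there. A coordinate forced to
    agree gives a factor [m], a free one [m ^ 2]. *)
Lemma sum_joint_ratio (R : realType) (m k : nat) :
  \sum_(t : 'I_m * 'I_m * 'I_m) \sum_(u : 'I_m * 'I_m * 'I_m)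
     joint_ratio R (agreements t u) ^+ k
  <= m%:R ^+ 6 + 3 * m%:R ^+ 5 * joint_ratio R 1 ^+ k
     + 3 * m%:R ^+ 4 * joint_ratio R 2 ^+ k + m%:R ^+ 3 * joint_ratio R 3 ^+ k.
Proof.
set r1 := _ ^+ k; set r2 := _ ^+ k; set r3 := _ ^+ k.
pose one (a b : 'I_m) : R := 1; pose e (a b : 'I_m) : R := (a == b)%:R.
pose P (f g h : 'I_m -> 'I_m -> R) (t u : 'I_m * 'I_m * 'I_m) :=
  f t.1.1 u.1.1 * g t.1.2 u.1.2 * h t.2 u.2.
have sumP f g h : \sum_t \sum_u P f g h t u =
    (\sum_a \sum_b f a b) * (\sum_a \sum_b g a b) * (\sum_a \sum_b h a b).
  rewrite -sum_pair_mul.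
  exact: (sum_pair_mul (fun x y => f x.1 y.1 * g x.2 y.2) h).
have sum_one : \sum_a \sum_b one a b = m%:R ^+ 2.
  rewrite (eq_bigr (fun=> m%:R)) => [|a _]; rewrite sumr_const card_ord //.
  by rewrite -[_ *+ _]mulr_natl expr2.
have sum_e : \sum_a \sum_b e a b = m%:R.
  rewrite (eq_bigr (fun=> 1)) ?sumr_const ?card_ord // => a _.
  by rewrite (bigD1 a) //= /e eqxx big1 ?addr0 // => b /negbTE; rewrite eq_sym => ->.
(* A pair with [d] agreements meets the term carrying the [d]-th ratio; all other terms are
   nonnegative, so counting pairs several times only enlarges [F]. *)
pose F t u := P one one one t u
  + (P e one one t u * r1 + P one e one t u * r1 + P one one e t u * r1)
  + (P e e one t u * r2 + P e one e t u * r2 + P one e e t u * r2)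
  + P e e e t u * r3.
apply: (@le_trans _ _ (\sum_t \sum_u F t u)).
  apply: ler_sum => t _; apply: ler_sum => u _.
  have r1_ge0 : 0 <= r1 by rewrite exprn_ge0 ?joint_ratio_ge0.
  have r2_ge0 : 0 <= r2 by rewrite exprn_ge0 ?joint_ratio_ge0.
  have r3_ge0 : 0 <= r3 by rewrite exprn_ge0 ?joint_ratio_ge0.
  have r0E : joint_ratio R 0 ^+ k = 1 by rewrite /joint_ratio divff ?expr1n.
  rewrite /F /P /one /e /agreements.
  case: (_ == _); case: (_ == _); case: (_ == _);
    rewrite /= ?addn0 ?add0n ?addn1 -?/r1 -?/r2 -?/r3 ?r0E; lra.
have split4 (a b c d : 'I_m * 'I_m * 'I_m -> 'I_m * 'I_m * 'I_m -> R) :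
  \sum_t \sum_u (a t u + b t u + c t u + d t u) = \sum_t \sum_u a t u
   + \sum_t \sum_u b t u + \sum_t \sum_u c t u + \sum_t \sum_u d t u.
  by rewrite -!big_split /=; apply: eq_bigr => t _; rewrite !big_split.
have split3 (a b c : 'I_m * 'I_m * 'I_m -> 'I_m * 'I_m * 'I_m -> R) r :
  \sum_t \sum_u (a t u * r + b t u * r + c t u * r) = (\sum_t \sum_u a t u
   + \sum_t \sum_u b t u + \sum_t \sum_u c t u) * r.
  rewrite -!big_split mulr_suml /=; apply: eq_bigr => t _.
  by rewrite -!big_split mulr_suml /=; apply: eq_bigr => u _; rewrite !mulrDl.
rewrite split4 !split3.
under [X in _ + X <= _]eq_bigr do rewrite -mulr_suml.
rewrite -mulr_suml !sumP !sum_one !sum_e.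
by rewrite le_eqVlt; apply/orP; left; apply/eqP; ring.
Qed.

(** * The probability bound for fixed [n] and [k] *)

Definition never_increasing (n m k : nat) (h : (3 * m <= n)%N)
    (t : 'I_m * 'I_m * 'I_m) : {set {ffun 'I_k -> 'S_n}} :=
  [set p : {ffun 'I_k -> 'S_n} | [forall j, p j \notin increasing_perms h t]]%SET.

Lemma card_ffun_forall (T : finType) (k : nat) (B : {set T}) :
  #|[set p : {ffun 'I_k -> T} | [forall j, p j \in B]]%SET| = (#|B| ^ k)%N.
Proof.
rewrite -[in RHS](card_ord k) -card_ffun_on; apply: eq_card => p.
by rewrite inE; apply/forallP/ffun_onP.
Qed.

(** Shattering [t] requires the identity pattern [1%g] in particular, and a permutation realising it
    is increasing on [t]. *)
Lemma shatters_all_triples_never (n m k : nat) (h : (3 * m <= n)%N)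
    (p : {ffun 'I_k -> 'S_n}) (t : 'I_m * 'I_m * 'I_m) :
  shatters_all_triples p -> p \notin never_increasing k h t.
Proof.
have lt_blocks : (block h (inord 0) t.1.1 < block h (inord 1) t.1.2
                  < block h (inord 2) t.2)%N.
  by have := ltn_ord t.1.1; have := ltn_ord t.1.2; rewrite /= !inordK //; lia.
move=> /forallP/(_ (block h (inord 0) t.1.1)).
move=> /forallP/(_ (block h (inord 1) t.1.2)).
move=> /forallP/(_ (block h (inord 2) t.2))/implyP/(_ lt_blocks).
move=> /forallP/(_ 1%g)/existsP[j /forallP isoj].
rewrite inE negb_forall; apply/existsP; exists j; rewrite negbK inE.
have /forallP/(_ (inord 1))/eqP := isoj (inord 0).
have /forallP/(_ (inord 2))/eqP := isoj (inord 1).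
by rewrite !(tnth_nth (block h ord0 t.2)) /= !perm1 !inordK //= => -> ->.
Qed.

Lemma prob_shatters_all_triples_le (R : realType) (n m k : nat) :
  (0 < m)%N -> (3 * m <= n)%N ->
  iid_uniform_prob R (@shatters_all_triples n k)
  <= 3 * (joint_ratio R 1 ^+ k / m%:R) + 3 * (joint_ratio R 2 ^+ k / m%:R ^+ 2)
     + joint_ratio R 3 ^+ k / m%:R ^+ 3.
Proof.
move=> m_gt0 h; rewrite iid_uniform_probE.
set W := #|{ffun _}|; set M : R := m%:R.
have WE : W%:R = (n`!)%:R ^+ k :> R by rewrite /W card_ffun card_Sn card_ord natrX.
have W_gt0 : 0 < W%:R :> R by rewrite WE exprn_gt0 // ltr0n fact_gt0.
have M_gt0 : 0 < M by rewrite ltr0n.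
pose A := never_increasing k h.
pose S : R := \sum_t #|A t|%:R.
pose Q : R := \sum_t \sum_u #|A t :&: A u|%SET%:R.
have SE : S = M ^+ 3 * (5 / 6) ^+ k * W%:R.
  rewrite /S (eq_bigr (fun=> (5 / 6) ^+ k * W%:R)) => [|t _].
    by rewrite sumr_const !card_prod card_ord -[_ *+ _]mulr_natl !natrM; ring.
  have -> : A t = [set p : {ffun 'I_k -> 'S_n} |
      [forall j, p j \in ~: increasing_perms h t]]%SET.
    by apply/setP => p; rewrite !inE; apply: eq_forallb => j; rewrite finset.in_setC.
  rewrite card_ffun_forall natrX WE -exprMn; congr (_ ^+ k).
  have := congr1 (fun x => x%:R : R) (card_setC_increasing h t).
  by rewrite !natrM; lra.
(* The [k] coordinates are independent, so the bound for one permutation,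
   [(120 + w) / 180 = 25 / 36 * joint_ratio], is raised to the power [k]. *)
have QE : Q <= (25 / 36) ^+ k * W%:R * \sum_(t : 'I_m * 'I_m * 'I_m)
    \sum_(u : 'I_m * 'I_m * 'I_m) joint_ratio R (agreements t u) ^+ k.
  rewrite mulr_sumr; apply: ler_sum => t _.
  rewrite mulr_sumr; apply: ler_sum => u _.
  have -> : (A t :&: A u)%SET = [set p : {ffun 'I_k -> 'S_n} |
      [forall j, p j \in ~: (increasing_perms h t :|: increasing_perms h u)]]%SET.
    apply/setP => p; rewrite !inE; apply/andP/forallP => [[/forallP a /forallP b] j|a].
      by rewrite finset.in_setC finset.in_setU negb_or a b.
    by split; apply/forallP => j; have := a j;
      rewrite finset.in_setC finset.in_setU negb_or => /andP[].
  rewrite card_ffun_forall natrX WE -!exprMn lerXn2r ?nnegrE //.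
    by rewrite !mulr_ge0 ?joint_ratio_ge0 //; lra.
  have := card_setC_joint_increasing h t u.
  rewrite -(ler_nat R) !natrM /joint_ratio; lra.
have Z_le : (#|@shatters_all_triples n k| <= #|[pred p | [forall t, p \notin A t]]|)%N.
  apply/subset_leq_card/fintype.subsetP => p hp; rewrite inE; apply/forallP => t.
  exact: shatters_all_triples_never.
have := second_moment_bound (A := A) (erefl S) (erefl Q).
rewrite -/W; set Z' := #|[pred _ | _]| in Z_le *; set Z := #|_| in Z_le *.
move: (sum_joint_ratio R m k) QE; rewrite -/M.
set D := \sum_t _; set r1 := _ ^+ k; set r2 := joint_ratio R 2 ^+ k.
set r3 := joint_ratio R 3 ^+ k => D_le QE SQ.
have c_gt0 : 0 < (5 / 6 : R) ^+ k by rewrite exprn_gt0 //; lra.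
have c2E : (25 / 36 : R) ^+ k = ((5 / 6) ^+ k) ^+ 2.
  by rewrite exprAC; congr (_ ^+ k); lra.
move: c_gt0 c2E SE QE; set c := (5 / 6 : R) ^+ k => c_gt0 -> SE QE.
have -> : 3 * (r1 / M) + 3 * (r2 / M ^+ 2) + r3 / M ^+ 3
    = (3 * M ^+ 5 * r1 + 3 * M ^+ 4 * r2 + M ^+ 3 * r3) / M ^+ 6.
  by field; rewrite gt_eqF.
rewrite ler_pdivrMr // mulrAC ler_pdivlMr ?exprn_gt0 //.
have K_gt0 : 0 < c ^+ 2 * W%:R ^+ 2 by rewrite mulr_gt0 ?exprn_gt0.
rewrite -(ler_pM2l K_gt0).
apply: (@le_trans _ _ (S ^+ 2 * Z'%:R)).
  rewrite SE [leRHS](_ : _ = c ^+ 2 * W%:R ^+ 2 * (Z'%:R * M ^+ 6)); last by ring.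
  by rewrite ler_pM2l // ler_pM2r ?exprn_gt0 // ler_nat.
apply: (le_trans SQ); rewrite SE.
(* The leading term [M ^+ 6] of the bound on [D] cancels against [S ^+ 2], leaving only the three
   terms with agreements. *)
apply: (@le_trans _ _ (W%:R * (W%:R * (c ^+ 2 * W%:R * (M ^+ 6
    + 3 * M ^+ 5 * r1 + 3 * M ^+ 4 * r2 + M ^+ 3 * r3))
    - (M ^+ 3 * c * W%:R) ^+ 2))).
  rewrite ler_pM2l // lerD2r ler_pM2l //; apply: (le_trans QE).
  by rewrite ler_pM2l // mulr_gt0 ?exprn_gt0.
by rewrite le_eqVlt; apply/orP; left; apply/eqP; ring.
Qed.

(** * Asymptotics *)

Local Open Scope classical_set_scope.
Local Open Scope ring_scope.

(** Each of the three ratios in the previous bound is at most [eps], and 3 + 3 + 1 = 7. *)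
Lemma prob_shatters_all_triples_small (R : realType) (n m k : nat) (eps : R) :
  (0 < m)%N -> (3 * m <= n)%N -> 0 < eps <= 1 ->
  (6 / 5) ^+ k <= eps ^+ 3 * m%:R ^+ 3 ->
  iid_uniform_prob R (@shatters_all_triples n k) <= 7 * eps.
Proof.
move=> m_gt0 le_3m_n /andP[eps_gt0 eps_le1].
set M : R := m%:R; have M_gt0 : 0 < M by rewrite ltr0n.
rewrite -exprMn => y_le.
have eM_ge0 : 0 <= eps * M by rewrite mulr_ge0 // ltW.
have rE d : joint_ratio R d = (120 + (joint_weight d)%:R) / 125.
  by rewrite /joint_ratio natrD.
have r3 : joint_ratio R 3 ^+ k / M ^+ 3 <= eps.
  rewrite ler_pdivrMr ?exprn_gt0 //.
  have -> : joint_ratio R 3 = 6 / 5 by rewrite rE /joint_weight /=; lra.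
  apply: (le_trans y_le); rewrite exprMn ler_pM2r ?exprn_gt0 //.
  by rewrite exprS ler_piMr ?exprn_ile1 // ltW.
(* Compare cubes, using [(129/125)^3 <= 6/5]. *)
have r1 : joint_ratio R 1 ^+ k / M <= eps.
  rewrite ler_pdivrMr // -(@ler_pXn2r _ 3) ?nnegrE ?exprn_ge0 ?joint_ratio_ge0 //.
  apply: le_trans y_le; rewrite exprAC lerXn2r ?nnegrE ?exprn_ge0 ?joint_ratio_ge0 //.
  by rewrite rE /joint_weight /=; lra.
(* Cubes again: [(27/25)^3 <= (6/5)^2] gives the stronger bound [eps ^+ 2]. *)
have r2 : joint_ratio R 2 ^+ k / M ^+ 2 <= eps.
  apply: (@le_trans _ _ (eps ^+ 2)); last by rewrite exprS expr1 ler_piMr // ltW.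
  rewrite ler_pdivrMr ?exprn_gt0 // -exprMn.
  rewrite -(@ler_pXn2r _ 3) ?nnegrE ?exprn_ge0 ?joint_ratio_ge0 //.
  rewrite [leRHS]exprAC; apply: (@le_trans _ _ (((6 / 5) ^+ k) ^+ 2)).
    rewrite [leLHS]exprAC [leRHS]exprAC lerXn2r ?nnegrE ?exprn_ge0 ?joint_ratio_ge0 //.
    by rewrite rE /joint_weight /=; lra.
  by rewrite lerXn2r ?nnegrE ?exprn_ge0 //; lra.
apply: (le_trans (prob_shatters_all_triples_le R k m_gt0 le_3m_n)).
by rewrite -/M; lra.
Qed.

(** Clearing the base-2 logarithms gives [k * ln 1.2 <= 3 * ln n - w * ln 2], which is then
    exponentiated. *)
Lemma expr_le_of_lg_le (R : realType) (n k : nat) (w : R) : (0 < n)%N ->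
  k%:R <= (3 * lg n%:R - w) / lg (12 / 10) ->
  (6 / 5) ^+ k <= n%:R ^+ 3 * expR (- (w * ln 2)).
Proof.
move=> n_gt0.
have ln2_gt0 : 0 < ln (2 : R) by rewrite ln_gt0 //; lra.
have l12_gt0 : 0 < ln (12 / 10 : R) by rewrite ln_gt0 //; lra.
rewrite /lg ler_pdivlMr ?divr_gt0 // => k_le.
have {k_le} : k%:R * ln (12 / 10) <= 3 * ln n%:R - w * ln (2 : R).
  rewrite -(ler_pM2r (_ : 0 < (ln (2 : R))^-1)) ?invr_gt0 //.
  apply: (le_trans _ (le_trans k_le _)); first by rewrite mulrA.
  by rewrite mulrBl mulrK ?unitfE ?gt_eqF // mulrA.
rewrite -ler_expR expRM_natl lnK ?posrE; last by lra.
rewrite expRD expRM_natl lnK ?posrE ?ltr0n //.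
by have -> : 12 / 10 = 6 / 5 :> R by lra.
Qed.

Theorem theorem3p3 (R : realType) (k : nat -> nat) (omega : nat -> R)
    (omega_infty : omega n @[n --> \oo] --> +oo)
    (k_le : forall n : nat, (0 < n)%N ->
      (k n)%:R <= (3 * lg n%:R - omega n) / lg (12 / 10)) :
  iid_uniform_prob R (@shatters_all_triples n (k n)) @[n --> \oo] --> (0 : R).
Proof.
apply/cvgr0Pnorm_le => e e_gt0.
pose eps : R := Num.min 1 (e / 7).
have eps_gt0 : 0 < eps by rewrite lt_min ltr01 divr_gt0.
have eps_le1 : eps <= 1 by rewrite ge_min lexx.
have eps_le : 7 * eps <= e by rewrite mulrC -ler_pdivlMr // ge_min lexx orbT.
have ln2_gt0 : 0 < ln (2 : R) by rewrite ln_gt0 //; lra.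
near=> n.
have n_ge3 : (3 <= n)%N by near: n; exact: nbhs_infty_ge.
(* This threshold makes [2^(- omega n)] at most [eps ^+ 3 / 125]; the 125 is the cube of the 5 in
   [n_le]. *)
have omega_ge : ln (125 / eps ^+ 3) / ln 2 <= omega n.
  by near: n; move/cvgryPge: omega_infty; exact.
rewrite ger0_norm; last first.
  by rewrite iid_uniform_probE divr_ge0.
apply: le_trans eps_le.
apply: (@prob_shatters_all_triples_small _ _ (n %/ 3)).
- by rewrite divn_gt0.
- by rewrite mulnC leq_divM.
- by rewrite eps_gt0.
have n_gt0 : (0 < n)%N by exact: leq_trans n_ge3.
apply: (le_trans (expr_le_of_lg_le n_gt0 (k_le n n_gt0))).
(* For [n >= 3] the worst case is [n = 5], where [n %/ 3 = 1]. *)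
have n_le : n%:R <= 5 * (n %/ 3)%:R :> R by rewrite -natrM ler_nat; lia.
have exp_le : expR (- (omega n * ln 2)) <= eps ^+ 3 / 125.
  rewrite expRN -[leRHS]invrK lef_pV2 ?posrE ?expR_gt0 ?invr_gt0 ?divr_gt0 ?exprn_gt0 //.
  rewrite invf_div -[leLHS]lnK ?posrE ?divr_gt0 ?exprn_gt0 // ler_expR.
  by rewrite -ler_pdivrMr.
apply: (@le_trans _ _ ((5 * (n %/ 3)%:R) ^+ 3 * (eps ^+ 3 / 125))).
  by rewrite ler_pM ?exprn_ge0 ?expR_ge0 // lerXn2r ?nnegrE ?mulr_ge0.
by rewrite le_eqVlt; apply/orP; left; apply/eqP; field.
Unshelve. all: by end_near.
Qed.
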